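(* Let $k$ be a field of characteristic $0$, let $GDN(a)$ be the free Gelfand-Dorfman-Novikov algebra over $k$ generated by one element $a$, and let $A=\langle a\circ a,\ (a\circ a)\circ a,\ ((a\circ a)\circ a)\circ a\rangle$ be the subalgebra of $GDN(a)$ generated by the set $\{a\circ a,\ (a\circ a)\circ a,\ ((a\circ a)\circ a)\circ a\}$. Then $A$ is not free (i.e. $A$ is not a free Gelfand-Dorfman-Novikov algebra on any set of generators).
   Context: A (right-)Gelfand-Dorfman-Novikov algebra over $k$ is a $k$-vector space with a bilinear product $\circ$ satisfying $x\circ(y\circ z)-(x\circ y)\circ z=x\circ(z\circ y)-(x\circ z)\circ y$ and $x\circ(y\circ z)=y\circ(x\circ z)$. Free algebras are taken in the variety of these algebras. Concretely, the free algebra on a set $X$ can be realized as follows: let $k\{X\}$ be the commutative polynomial algebra in letters $a[i]$ ($a\in X$, $i\ge-1$) with derivation $D$, $D(a[i])=a[i+1]$; the span of all monomials $a_1[i_1]\cdots a_n[i_n]$ with $i_1+\dots+i_n=-1$, with the product $f\circ g=(Df)g$, is the free Gelfand-Dorfman-Novikov algebra on $X$, with $a\in X$ identified with $a[-1]$. *)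

(* Defs.v *)
From HB Require Import structures.
From mathcomp Require Import all_boot all_order all_algebra.
From mathcomp Require Import boolp classical_sets.

Set Implicit Arguments.
Unset Strict Implicit.
Unset Printing Implicit Defensive.

Import GRing.Theory.
Local Open Scope classical_set_scope.
Local Open Scope ring_scope.

Reserved Notation "x <o> y" (at level 40, left associativity).

(* GDN = right Gelfand-Dorfman-Novikov; MathComp with mathcomp-classical. *)
HB.mixin Record Lmodule_isGDN (k : fieldType) V of GRing.Lmodule k V := {
  circ : V -> V -> V;
  circ_linearl : forall y, linear (circ^~ y);
  circ_linearr : forall x, linear (circ x);
  circ_rsym : forall x y z,
    circ x (circ y z) - circ (circ x y) z
    = circ x (circ z y) - circ (circ x z) y;
  circ_lcomm : forall x y z, circ x (circ y z) = circ y (circ x z)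
}.

#[short(type="gdnType")]
HB.structure Definition GDN (k : fieldType) :=
  {V of GRing.Lmodule k V & Lmodule_isGDN k V}.

Notation "x <o> y" := (circ x y) : ring_scope.

Definition gdn_hom (k : fieldType) (A B : gdnType k) (f : A -> B) : Prop :=
  linear f /\ {morph f : x y / x <o> y}.

(* Universal property in the variety of GDN algebras over k.  Injectivity of
   [i] is not required, as it follows from the property. *)
Definition free_on (k : fieldType) (A : gdnType k) (X : Type) (i : X -> A) :
    Prop :=
  forall (B : gdnType k) (g : X -> B),
    exists f : A -> B, [/\ gdn_hom f, forall x, f (i x) = g x
      & forall h : A -> B, gdn_hom h -> (forall x, h (i x) = g x) -> h =1 f].

Definition is_free (k : fieldType) (A : gdnType k) : Prop :=
  exists (X : Type) (i : X -> A), free_on i.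

Section GeneratedSubalgebra.
Variables (k : fieldType) (A : gdnType k).
Implicit Types S P : set A.

Definition subalgebra P : Prop :=
  [/\ P 0, forall (c : k) x y, P x -> P y -> P (c *: x + y)
    & forall x y, P x -> P y -> P (x <o> y)].

Definition gen S : set A := smallest subalgebra S.

Lemma subalgebra_gen S : subalgebra (gen S).
Proof.
split=> [P [[P0 _ _] _] //|c x y Sx Sy P PS|x y Sx Sy P PS].
- by have [[_ PL _] _] := PS; apply: PL; [apply: Sx|apply: Sy].
- by have [[_ _ PM] _] := PS; apply: PM; [apply: Sx|apply: Sy].
Qed.

Definition gen_pred S : A -> bool := fun x => `[< gen S x >].

Lemma gen_predP S x : reflect (gen S x) (gen_pred S x).
Proof. exact: asboolP. Qed.

Lemma gen_submod_closed S : submod_closed (gen_pred S).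
Proof.
have [S0 SL _] := subalgebra_gen S; split; first by apply/gen_predP.
by move=> c x y /gen_predP Sx /gen_predP Sy; apply/gen_predP; apply: SL.
Qed.

HB.instance Definition _ S :=
  GRing.isSubmodClosed.Build k A (gen_pred S)
    (GRing.submod_closed_semi (gen_submod_closed S)).

(* The subalgebra generated by [S] as an algebra in its own right. *)
Record gen_alg S : Type := GenAlg {
  gen_val : A;
  gen_valP : gen_pred S gen_val
}.

HB.instance Definition _ S := [isSub for @gen_val S].
HB.instance Definition _ S := [Choice of gen_alg S by <:].
HB.instance Definition _ S :=
  [SubChoice_isSubLmodule of gen_alg S by <:].

Lemma gen_pred_circ S (x y : gen_alg S) :
  gen_pred S (gen_val x <o> gen_val y).
Proof.
have [_ _ SM] := subalgebra_gen S.
by apply/gen_predP; apply: SM; apply/gen_predP; apply: gen_valP.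
Qed.

Definition gen_circ S (x y : gen_alg S) : gen_alg S :=
  GenAlg (gen_pred_circ x y).

Lemma val_gen_circ S (x y : gen_alg S) :
  val (gen_circ x y) = val x <o> val y.
Proof. by []. Qed.

Fact gen_circ_linearl S (y : gen_alg S) : linear ((@gen_circ S)^~ y).
Proof.
move=> c x z; apply: val_inj; rewrite linearP !val_gen_circ linearP.
exact: circ_linearl.
Qed.

Fact gen_circ_linearr S (x : gen_alg S) : linear (@gen_circ S x).
Proof.
move=> c y z; apply: val_inj; rewrite linearP !val_gen_circ linearP.
exact: circ_linearr.
Qed.

Fact gen_circ_rsym S (x y z : gen_alg S) :
  gen_circ x (gen_circ y z) - gen_circ (gen_circ x y) z
  = gen_circ x (gen_circ z y) - gen_circ (gen_circ x z) y.
Proof.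
by apply: val_inj; rewrite !raddfB; apply: circ_rsym.
Qed.

Fact gen_circ_lcomm S (x y z : gen_alg S) :
  gen_circ x (gen_circ y z) = gen_circ y (gen_circ x z).
Proof. by apply: val_inj; apply: circ_lcomm. Qed.

HB.instance Definition _ S := Lmodule_isGDN.Build k (gen_alg S)
  (@gen_circ_linearl S) (@gen_circ_linearr S)
  (@gen_circ_rsym S) (@gen_circ_lcomm S).

End GeneratedSubalgebra.

(* Main.v *)
(** In [A], put [u = a a], [v = u a] and [w = v a].  Left commutativity gives
    [u w = u (v a) = v (u a) = v v].  In a free algebra, by contrast, every
    linear functional [phi] killing all products is the first coordinate of a
    homomorphism to an algebra where the product of [x] and [y] has second
    coordinate [phi x * phi y], so that [phi u * phi w = phi v ^+ 2].  The
    functional extracting the coefficient of [(a a) a] kills the products of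
    [A], as these have degree at least 4, and it sends [u], [v], [w] to
    [0], [1], [0]. *)
Require Import Defs.
From HB Require Import structures.
From mathcomp Require Import all_boot all_order all_algebra.
From mathcomp Require Import boolp classical_sets.
From mathcomp Require Import ring.

Import GRing.Theory.
Local Open Scope classical_set_scope.
Local Open Scope ring_scope.

(* Basis [e1, e2, e3], the only nonzero products being [e1 e1 = e2] and
   [e2 e1 = e3]: the quotient of the one-generated free algebra by
   [e1 (e1 e1)] and the degrees above 3. *)
Definition trunc (k : fieldType) : Type := (k^o * k^o * k^o)%type.

HB.instance Definition _ (k : fieldType) :=
  GRing.Lmodule.copy (trunc k) (k^o * k^o * k^o)%type.

Section Trunc.
Variable k : fieldType.

Definition trunc_circ (x y : trunc k) : trunc k := (0, x.1.1 * y.1.1, x.1.2 * y.1.1).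

Fact trunc_circ_linearl y : linear (trunc_circ^~ y).
Proof.
by move=> c x z; congr (_, _, _); rewrite /= /GRing.scale /=; ring.
Qed.

Fact trunc_circ_linearr x : linear (trunc_circ x).
Proof.
by move=> c y z; congr (_, _, _); rewrite /= /GRing.scale /=; ring.
Qed.

Fact trunc_circ_rsym x y z :
  trunc_circ x (trunc_circ y z) - trunc_circ (trunc_circ x y) z
  = trunc_circ x (trunc_circ z y) - trunc_circ (trunc_circ x z) y.
Proof. by congr (_, _, _); rewrite /=; ring. Qed.

Fact trunc_circ_lcomm x y z :
  trunc_circ x (trunc_circ y z) = trunc_circ y (trunc_circ x z).
Proof. by congr (_, _, _); rewrite /=; ring. Qed.

HB.instance Definition _ := Lmodule_isGDN.Build k (trunc k)
  trunc_circ_linearl trunc_circ_linearr trunc_circ_rsym trunc_circ_lcomm.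

Lemma trunc_circE (x y : trunc k) : x <o> y = (0, x.1.1 * y.1.1, x.1.2 * y.1.1).
Proof. by []. Qed.

(** [e3] annihilates [trunc k] on both sides, so products vanish in the image too. *)
Lemma gdn_hom_trunc3 (A : gdnType k) (phi : A -> k^o) :
    linear phi -> (forall x y, phi (x <o> y) = 0) ->
  gdn_hom (fun x => (0, 0, phi x) : trunc k).
Proof.
move=> phiL phi0; split=> [c x y|x y].
  by congr (_, _, _); rewrite /= ?scaler0 ?addr0 ?phiL.
by rewrite trunc_circE phi0 /= !mul0r.
Qed.

Lemma free_functional_mul (A : gdnType k) (phi : A -> k^o) (u v u' v' : A) :
    is_free A -> linear phi -> (forall x y, phi (x <o> y) = 0) ->
    u <o> v = u' <o> v' ->
  phi u * phi v = phi u' * phi v'.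
Proof.
move=> [X [i freeA]] phiL phi0 uv.
have [f [[fL fM] fi _]] := freeA (trunc k) (fun x => (phi (i x), 0, 0)).
have f1L : linear (fun x => (f x).1.1 : k^o) by move=> c x y; rewrite fL.
have f1M x y : (f (x <o> y)).1.1 = 0 by rewrite fM.
have [g [_ _ gU]] := freeA (trunc k) (fun x => (0, 0, phi (i x))).
(* Both functionals kill products and agree on generators; placed on [e3], they become
   homomorphisms, which uniqueness identifies. *)
have f1E x : (f x).1.1 = phi x.
  have /(congr1 snd) /= -> := gU _ (gdn_hom_trunc3 _ _ f1L f1M)
    (fun x => congr1 (fun t => (0, 0, t.1.1)) (fi x)) x.
  by have /(congr1 snd) /= <- := gU _ (gdn_hom_trunc3 _ _ phiL phi0)
    (fun x => erefl) x.
by rewrite -!f1E; have /(congr1 (fun x => (f x).1.2)) := uv; rewrite !fM.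
Qed.

End Trunc.

Lemma subalgebra_gdn_hom_preim (k : fieldType) (A B : gdnType k) (h : A -> B)
    (P : set B) : gdn_hom h -> subalgebra P -> subalgebra (h @^-1` P).
Proof.
move=> [hL hM] [P0 PL PM]; split=> [|c x y Px Py|x y Px Py] /=.
- by have := hL (-1) 0 0; rewrite scaler0 addr0 scaleN1r addNr => ->.
- by rewrite hL; apply: PL.
- by rewrite hM; apply: PM.
Qed.

Theorem theorem4 (k : fieldType) (chark0 : [pchar k] =i pred0)
    (GDNa : gdnType k) (a : GDNa) (freeGDNa : free_on (fun _ : unit => a)) :
  ~ is_free (gen_alg [set a <o> a; (a <o> a) <o> a; ((a <o> a) <o> a) <o> a]).
Proof.
set S := [set _; _; _] => freeA.
(* With [a] sent to [e1], the third coordinate of [h] is the coefficient of [(a a) a]. *)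
have [h [hH ha _]] := freeGDNa (trunc k) (fun _ => (1, 0, 0)).
have [hL hM] := hH; have {}ha := ha tt.
have hu : h (a <o> a) = (0, 1, 0).
  by rewrite hM ha trunc_circE /= !mulr1.
have hv : h (a <o> a <o> a) = (0, 0, 1).
  by rewrite hM hu ha trunc_circE /= !mulr1.
have hw : h (a <o> a <o> a <o> a) = 0.
  by rewrite hM hv ha trunc_circE /= !mul0r.
(* A product has an [e3] part only if its right factor has an [e1] part. No element of [gen_alg S]
   has one: the vectors without [e1] part form a subalgebra containing the images of [S]. *)
have h1 (x : gen_alg S) : (h (val x)).1.1 = 0.
  have /gen_predP := gen_valP x.
  apply: (_ : gen S `<=` (fun t => (h t).1.1 = 0)); apply: smallest_sub;
    last by move=> _ [[->|->]|->] /=; rewrite ?hu ?hv ?hw.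
  apply: (subalgebra_gdn_hom_preim _ _ _ h (fun t => t.1.1 = 0)) => //.
  by split=> // c x' y' /= -> ->; rewrite scaler0 addr0.
have Sgen x : S x -> gen_pred S x by move=> Sx; apply/gen_predP => P [_]; apply.
pose u : gen_alg S := GenAlg (Sgen _ (or_introl (or_introl erefl))).
pose v : gen_alg S := GenAlg (Sgen _ (or_introl (or_intror erefl))).
pose w : gen_alg S := GenAlg (Sgen _ (or_intror erefl)).
have uw : u <o> w = v <o> v by apply: val_inj; apply: circ_lcomm.
pose phi (x : gen_alg S) : k^o := (h (val x)).2.
have phiL : linear phi by move=> c x y; rewrite /phi linearP hL.
have phi0 x y : phi (x <o> y) = 0.
  by rewrite /phi [val _]/(val x <o> val y) hM trunc_circE /= h1 mulr0.
have := free_functional_mul _ _ _ _ _ _ _ freeA phiL phi0 uw.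
rewrite /phi /= hu hv hw mul0r mulr1 => /esym/eqP.
by rewrite oner_eq0.
Qed.
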